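(* Let $Y$ be a complex Banach space, let $\Omega:\mathcal{P}(Y)\to[0,+\infty]$ be a measure of non-compactness in $Y$, let $C\subset Y$ be a non-empty, convex, bounded and closed subset with $\Omega(C)<\infty$, and let $\psi:[0,\infty)\to[0,\infty)$ be a nondecreasing function such that $\lim_{n\to\infty}\psi^{(n)}(t)=0$ for every $t\ge 0$. If $\Phi:C\to C$ is a continuous function such that $\Omega(\Phi(A))\le\psi(\Omega(A))$ for all $A\subset C$, then $\Phi$ has at least one fixed point in $C$.
   Context: $\psi^{(n)}$ denotes the $n$-fold iterate (composition) of $\psi$. A measure of non-compactness in a complex Banach space $Y$ is a function $\Omega:\mathcal{P}(Y)\to[0,+\infty]$ on the power set of $Y$ such that for all $A,B\subset Y$ and $\lambda\in\mathbb{C}$: (MN1) $\Omega(A)=0$ if and only if $A$ is relatively compact; (MN2) $A\subset B$ implies $\Omega(A)\le\Omega(B)$; (MN3) $\Omega(\overline{A})=\Omega(A)$; (MN4) $\Omega(\lambda A)=|\lambda|\Omega(A)$ (with $0\cdot(+\infty)=0$); (MN5) if $A$ is finite and $A\cap B=\emptyset$ then $\Omega(A\cup B)=\Omega(B)$; (MN6) $\Omega(\operatorname{conv}(A))=\Omega(A)$, where $\operatorname{conv}$ is the convex hull. *)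

(* Defs.v *)
From mathcomp Require Import all_boot all_order all_algebra complex.
From mathcomp Require Import all_classical all_reals all_analysis.

Set Implicit Arguments.
Unset Strict Implicit.
Unset Printing Implicit Defensive.

Import Order.TTheory GRing.Theory Num.Theory.
Import numFieldNormedType.Exports.

Local Open Scope classical_set_scope.
Local Open Scope ring_scope.

(** In [R[i]] the order is partial: [0 <= l <= 1] forces [l] to be real, so
    [convex_set] over [R[i]] is ordinary (real) convexity. *)
Definition convex_hull (R : realType) (Y : lmodType R[i]) (A : set Y) : set Y :=
  smallest (@convex_set R[i] Y) A.

(** [precompact A] is equivalent to [compact (closure A)] ([precompactE]).
    [normc] is the modulus as an element of [R]; in [\bar R], [0 * +oo = 0]. *)
Record noncompactness_measure (R : realType) (Y : completeNormedModType R[i])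
    (Omega : set Y -> \bar R) : Prop := NoncompactnessMeasure {
  mnc_ge0 : forall A, (0 <= Omega A)%E ;
  mnc_eq0 : forall A, Omega A = 0%E <-> precompact A ;
  mnc_le : forall A B, A `<=` B -> (Omega A <= Omega B)%E ;
  mnc_closure : forall A, Omega (closure A) = Omega A ;
  mnc_scale : forall (lambda : R[i]) A,
    Omega [set lambda *: x | x in A] =
      ((ComplexField.Normc.normc lambda)%:E * Omega A)%E ;
  mnc_finite : forall A B, finite_set A -> A `&` B = set0 ->
    Omega (A `|` B) = Omega B ;
  mnc_convex_hull : forall A, Omega (convex_hull A) = Omega A
}.

(* Main.v *)
Require Import Defs.
From mathcomp Require Import all_boot zify.

Set Implicit Arguments.
Unset Strict Implicit.
Unset Printing Implicit Defensive.

(** The proof reduces the theorem to Schauder's fixed point theorem, which is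
    proved here from a combinatorial lemma.

    Reduction ([minimal_invariant]).  Fix [x0] in [C] and let [K] be the
    smallest closed convex [Phi]-invariant set that contains [x0].  Minimality
    puts [K] inside the closed convex hull of [Phi @` K `|` [set x0]].  None of
    closure, convex hull and adding a point increases [Omega], so
    [Omega K <= psi (Omega K)].  By monotonicity of [psi] the number [Omega K]
    is below all iterates of [psi] at [Omega K], which tend to [0].  Hence
    [Omega K = 0] and [K] is compact.

    Schauder's theorem ([schauder]).  A point [x] with
    [|f x - x| <= |f x - y|] for all [y] in [K] is fixed, as [y = f x] shows.
    By compactness it suffices to satisfy finitely many of these inequalities,
    and for points [y_0, ..., y_n] one can look for [x] among their convex
    combinations ([best_approx_finite]).  This is done with a covering theorem
    for the simplex ([simplex_covering]): closed sets [G_0, ..., G_n] that cover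
    the simplex, with [G_i] containing the face [l_i = 0], have a common point.

    The covering theorem follows by compactness from a statement on colored
    grids ([grid_covering]), which is deduced from Scarf's lemma
    ([scarf_colorful]) and not from Sperner's lemma, so that no triangulation is
    needed: small simplices are replaced by sets of grid points that are
    dominant for the orders given by the coordinates.  Scarf's lemma itself is
    the usual parity argument on rooms and doors. *)

(** * Scarf's lemma *)

Section Scarf.
Variables (I Z : finType) (r : I -> Z -> nat) (e : I -> Z).

(** Seen through the coordinates [r i], no point of [Z] lies strictly inside the
    orthant whose corner consists of the minima of [U]. *)
Definition dominant (U : {set Z}) :=
  [forall y, exists i, forall u in U, r i y <= r i u].

Lemma dominantP (U : {set Z}) :
  reflect (forall y, exists i, forall u, u \in U -> r i y <= r i u)
          (dominant U).
Proof.
apply: (iffP forallP) => domU y; have := domU y.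
  by move=> /existsP[i /forall_inP le_yU]; exists i.
by move=> [i le_yU]; apply/existsP; exists i; apply/forall_inP.
Qed.

Lemma dominantS (U V : {set Z}) : U \subset V -> dominant V -> dominant U.
Proof.
move=> /subsetP sUV /dominantP domV; apply/dominantP => y.
by have [i le_yV] := domV y; exists i => u /sUV /le_yV.
Qed.

Hypothesis r_inj : forall i, injective (r i).
Hypothesis e_inj : injective e.
(* The slack element [e i] replaces the constraint [x_i >= 0]: it is the least
   element for [r i] and lies above every proper point for the other ranks. *)
Hypothesis e_bottom : forall i z, r i (e i) <= r i z.
Hypothesis e_top :
  forall i j z, j != i -> z \notin codom e -> r i z < r i (e j).

Definition slack_but i0 : {set Z} := [set e j | j in [set~ i0]].

(** A door is a dominant set with [#|I| - 1] elements and a room is a dominant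
    set with [#|I|] elements.  In this section [U] is a door and [m i] is its
    minimum for [r i].  By dominance every element of [U] is such a minimum, so
    [m] takes each value once, except for one collision [m a = m b].  A room
    [z |: U] needs one of these two indices for its new element [z]. *)
Section RegularDoor.
Variables (U : {set Z}) (m : I -> Z) (a b : I).
Hypothesis domU : dominant U.
Hypothesis mU : forall i, m i \in U.
Hypothesis m_min : forall i u, u \in U -> r i (m i) <= r i u.
Hypothesis a_neq_b : a != b.
Hypothesis m_ab : m a = m b.

(* The new element for the index [i] must exceed the other minima (set [M i])
   and be the largest such point, as otherwise the enlarged set would not be
   dominant (set [top i]). *)
Let M i : {set Z} := [set y | [forall j, (j != i) ==> (r j (m j) < r j y)]].
Let top i : {set Z} := [set z in M i | [forall y in M i, r i y <= r i z]].

Let mem_M i y : reflect (forall j, j != i -> r j (m j) < r j y) (y \in M i).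
Proof.
rewrite inE; apply: (iffP forallP) => h j; first by move/(implyP (h j)).
by apply/implyP/h.
Qed.

Let mem_top i z :
  reflect (z \in M i /\ forall y, y \in M i -> r i y <= r i z) (z \in top i).
Proof.
rewrite [z \in top i]in_set; apply: (iffP andP) => -[zM z_max]; split=> //.
  exact/forall_inP.
exact/forall_inP.
Qed.

Let surj_m u : u \in U -> exists i, u = m i.
Proof.
move=> uU; have [i le_u] := dominantP _ domU u; exists i.
by apply: (@r_inj i); apply/eqP; rewrite eqn_leq le_u// m_min.
Qed.

Let M_bound i y : y \in M i -> r i y <= r i (m i).
Proof.
move=> /mem_M yM; have [j le_yU] := dominantP _ domU y.
have [<-|/yM] := eqVneq j i; first exact: le_yU.
by rewrite ltnNge le_yU.
Qed.

Let card_top i : M i != set0 -> #|top i| = 1.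
Proof.
case/set0Pn => y0 y0M.
case: (@arg_maxnP _ y0 (mem (M i)) (r i) y0M) => z /= zM z_max.
apply/eqP/cards1P; exists z; apply/setP => y; rewrite !inE.
apply/idP/eqP => [|->].
  case/andP => yM /forall_inP y_max; apply: (@r_inj i); apply/eqP.
  by rewrite eqn_leq y_max// z_max// inE.
by move: (zM); rewrite inE => -> /=; apply/forall_inP.
Qed.

Let top_room (a' b' : I) z : a' != b' -> m a' = m b' -> z \in top a' ->
  z \notin U /\ dominant (z |: U).
Proof.
move=> neq_ab mab /mem_top[zM z_max]; have /mem_M z_gt := zM; split.
  apply/negP => /surj_m[k def_z]; have [ka|/z_gt] := eqVneq k a'; last first.
    by rewrite def_z ltnn.
  by have := z_gt b'; rewrite eq_sym def_z ka mab ltnn => /(_ neq_ab).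
apply/dominantP => y; have [yM|yM] := boolP (y \in M a').
  exists a' => u /setU1P[->|uU]; first exact: z_max.
  by apply: leq_trans (M_bound yM) (m_min _ uU).
have [j] : exists2 j, j != a' & r j y <= r j (m j).
  move: yM; rewrite inE negb_forall => /existsP[j].
  by rewrite negb_imply -leqNgt => /andP[]; exists j.
move=> ja le_y; exists j => u /setU1P[->|uU].
  exact: leq_trans le_y (ltnW (z_gt _ ja)).
exact: leq_trans le_y (m_min _ uU).
Qed.

Hypothesis cardU : #|U|.+1 = #|I|.

(* Either of the colliding indices can be dropped without losing a value. *)
Let m_inj (k i j : I) : k \in [set a; b] -> i != k -> j != k ->
  m i = m j -> i = j.
Proof.
move=> k_ab; have [k' k'k mk] : exists2 k', k' != k & m k' = m k.
  case/set2P: k_ab => ->; [by exists b; rewrite // eq_sym | by exists a].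
suff inj : {in [set~ k] &, injective m}.
  by move=> ik jk; apply: inj; rewrite !inE.
apply/imset_injP; have -> : [set m x | x in [set~ k]] = U.
  apply/setP => u; apply/imsetP/idP => [[x _ ->//]|/surj_m[x ->]].
  by have [->|xk] := eqVneq x k; [exists k'|exists x]; rewrite ?inE ?mk.
by rewrite cardsC1 -cardU.
Qed.

Let room_top z : z \notin U -> dominant (z |: U) -> exists2 i,
  i \in [set a; b] & z \in top i.
Proof.
move=> zU dom_zU.
have min_zU u : u \in z |: U ->
    exists i, forall v, v \in z |: U -> r i u <= r i v.
  by move=> _; apply: (dominantP _ dom_zU).
have [i z_min] := min_zU z (setU11 _ _).
have lt_z v : v \in U -> r i z < r i v.
  move=> vU; rewrite ltn_neqAle z_min ?inE ?vU ?orbT// andbT.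
  by apply: contraNneq zU => /r_inj ->.
have m_zU u : u \in U -> exists2 k, u = m k & r k u < r k z.
  move=> uU; have [|k le_u] := min_zU u; first by rewrite inE uU orbT.
  exists k.
    apply: (@r_inj k); apply/eqP.
    by rewrite eqn_leq m_min// le_u ?inE ?mU ?orbT.
  rewrite ltn_neqAle le_u ?setU11// andbT.
  by apply: contraNneq zU => /r_inj <-.
have i_ab : i \in [set a; b].
  have [k mk ltk] := m_zU _ (mU i).
  have ki : i != k.
    by apply: contraTneq ltk => <-; rewrite -leqNgt ltnW// lt_z.
  apply: contraNT ki => i_ab; apply/eqP.
  have [ia ib] : i != a /\ i != b by move: i_ab; rewrite !inE negb_or => /andP.
  have [ka|ka] := eqVneq k a; last by apply: (@m_inj a); rewrite ?inE ?eqxx.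
  suff : i = b by move/eqP; rewrite (negPf ib).
  by apply: (@m_inj a); rewrite ?inE ?eqxx// 1?eq_sym// mk ka m_ab.
exists i => //; apply/mem_top; split; last first.
  move=> y /mem_M yM; have [k le_y] := dominantP _ dom_zU y.
  have [<-|/yM] := eqVneq k i; first exact/le_y/setU11.
  by rewrite ltnNge le_y// inE mU orbT.
(* If [z] were the minimum for both [i] and [j], only [#|I| - 2] indices would
   be left for the [#|I| - 1] elements of [U]. *)
apply/mem_M => j ji; rewrite ltnNge; apply/negP => le_z.
suff : #|U| <= #|[set~ i] :\ j|.
  have := cardsD1 j [set~ i]; rewrite !inE ji add1n => card_ij.
  by rewrite -ltnS -card_ij cardsC1 -cardU ltnn.
apply: leq_trans (leq_imset_card m _); apply/subset_leq_card/subsetP => u uU.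
have [k def_u ltk] := m_zU u uU; apply/imsetP; exists k => //.
rewrite !inE; apply/andP; split; apply: contraTneq ltk => ->.
  by rewrite -leqNgt (leq_trans le_z)// m_min.
by rewrite -leqNgt ltnW// lt_z.
Qed.

Hypothesis U_nslack : forall i, U != slack_but i.

(* An empty [M i] excludes [e i] through some rank [r j], which lies below
   [e i] only at slack elements: then [U] is [slack_but j]. *)
Let M_neq0 i : M i != set0.
Proof.
apply/negP => /eqP M0; have : e i \notin M i by rewrite M0 inE.
rewrite inE negb_forall => /existsP[j]; rewrite negb_imply -leqNgt.
case/andP => ji le_e; have le_eU u : u \in U -> r j (e i) <= r j u.
  by move=> uU; apply: leq_trans le_e (m_min _ uU).
have /negP := U_nslack j; apply; rewrite eqEcard; apply/andP; split.
  apply/subsetP => u uU; have [/codomP[k uk]|nu] := boolP (u \in codom e).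
    rewrite uk imset_f// !inE; apply: contraNneq ji => kj.
    have uj : u = e j by rewrite uk kj.
    apply/eqP/esym/e_inj/(@r_inj j)/eqP.
    by rewrite eqn_leq e_bottom andbT -uj le_eU.
  have := @e_top j i u; rewrite eq_sym => /(_ ji nu).
  by rewrite ltnNge le_eU.
by rewrite card_imset// cardsC1 -cardU.
Qed.

Lemma card_rooms_of_minima : #|[set z | (z \notin U) && dominant (z |: U)]| = 2.
Proof.
have -> : [set z | (z \notin U) && dominant (z |: U)] = top a :|: top b.
  apply/setP => z; rewrite [LHS]inE [RHS]inE; apply/andP/orP => [[zU domzU]|].
    by have [i /set2P[] ->] := room_top zU domzU; [left|right].
  by case; [exact: (@top_room a b)|apply: (@top_room b a); rewrite 1?eq_sym].
rewrite cardsU !card_top//.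
suff -> : top a :&: top b = set0 by rewrite cards0.
apply/setP => z; rewrite [LHS]inE [RHS]inE; apply/negP.
case/andP => /mem_top[/mem_M za _] /mem_top[/mem_M zb _].
have [j le_z] := dominantP _ domU z.
have : r j (m j) < r j z.
  by have [->|/za//] := eqVneq j a; apply: zb.
by rewrite ltnNge le_z.
Qed.
End RegularDoor.

(** A regular door leads into two rooms, one on each side. *)
Lemma card_rooms_regular (U : {set Z}) :
  dominant U -> #|U|.+1 = #|I| -> (forall i, U != slack_but i) ->
  #|[set z | (z \notin U) && dominant (z |: U)]| = 2.
Proof.
move=> domU cardU U_nslack.
have [u0 u0U] : exists u, u \in U.
  apply/set0Pn/negP => /eqP U0; rewrite {domU}U0 cards0 in cardU U_nslack.
  have /card_gt0P[i _] : 0 < #|I| by rewrite -cardU.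
  have /negP := U_nslack i; apply.
  by rewrite eq_sym -cards_eq0 card_imset// cardsC1 -cardU.
pose m i := [arg min_(u < u0 in U) r i u].
have mP i : m i \in U /\ forall u, u \in U -> r i (m i) <= r i u.
  by rewrite /m; case: arg_minnP.
have [mU m_min] := (fun i => (mP i).1, fun i => (mP i).2).
have /injectivePn[a [b ab m_ab]] : ~~ injectiveb m.
  apply/negP => /injectiveP m_inj.
  have /subset_leq_card : m @: setT \subset U.
    by apply/subsetP => _ /imsetP[i _ ->].
  by rewrite card_imset// cardsT -cardU ltnn.
exact: (@card_rooms_of_minima U m a b).
Qed.

Variable x0 : Z.
Hypothesis x0_nslack : x0 \notin codom e.

Lemma dominant_slack_but i0 : dominant (slack_but i0).
Proof.
apply/dominantP => y; have [/codomP[j ->]|ny] := boolP (y \in codom e).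
  by exists j => u _; apply: e_bottom.
exists i0 => _ /imsetP[j ji ->]; rewrite ltnW// e_top//.
by move: ji; rewrite !inE.
Qed.

(** Doors made of slack elements lie on the boundary: one side only.  The room
    is obtained by adding the largest proper point for [r i0]. *)
Lemma card_rooms_slack_but i0 :
  #|[set z | (z \notin slack_but i0) && dominant (z |: slack_but i0)]| = 1.
Proof.
have [x x_ne x_max] := @arg_maxnP _ x0 [predC codom e] (r i0) x0_nslack.
apply/eqP/cards1P; exists x; apply/setP => z; rewrite !inE.
apply/andP/eqP => [[zS dom_z]|->]; last first.
  split; first by apply: contraNN x_ne => /imsetP[j _ ->]; apply: codom_f.
  apply/dominantP => y; have [/codomP[j ->]|ny] := boolP (y \in codom e).
    by exists j => u _; apply: e_bottom.
  exists i0 => u /setU1P[->|/imsetP[j ji ->]]; first exact: x_max.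
  by rewrite ltnW// e_top//; move: ji; rewrite !inE.
have z_ge y : y \notin codom e -> r i0 y <= r i0 z.
  move=> ny; have [i le_y] := dominantP _ dom_z y.
  have [<-|ii0] := eqVneq i i0; first exact/le_y/setU11.
  have := le_y (e i); rewrite inE imset_f ?inE// orbT => /(_ isT) le_e.
  case/negP: ny; suff -> : y = e i by apply: codom_f.
  by apply: (@r_inj i); apply/eqP; rewrite eqn_leq le_e e_bottom.
have z_ne : z \notin codom e.
  apply/codomP => -[j zj]; have ji0 : j = i0.
    by apply: contraNeq zS => ji; rewrite zj imset_f// !inE.
  have := z_ge x x_ne; rewrite zj ji0 => le_x; case/negP: x_ne.
  suff -> : x = e i0 by apply: codom_f.
  by apply: (@r_inj i0); apply/eqP; rewrite eqn_leq le_x e_bottom.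
by apply: (@r_inj i0); apply/eqP; rewrite eqn_leq z_ge// andbT; apply: x_max.
Qed.

Variable c : Z -> I.
Hypothesis c_e : cancel e c.

(** If the colors of [V] are exactly those other than [i0], one color is
    repeated and either of its two carriers can be removed.  If [V] misses a
    color in any other way, no removal leaves exactly these colors. *)
Lemma card_doors_even i0 (V : {set Z}) : #|V| = #|I| -> c @: V != setT ->
  ~~ odd #|[set z in V | c @: (V :\ z) == [set~ i0]]|.
Proof.
move=> cardV cV.
have [->|] := set_0Vmem [set z in V | c @: (V :\ z) == [set~ i0]].
  by rewrite cards0.
case=> z; rewrite inE => /andP[zV /eqP cVz].
have c_inj : {in V :\ z &, injective c}.
  apply/imset_injP; rewrite cVz cardsC1 -cardV.
  by rewrite (cardsD1 z V) zV add1n.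
have cz : c z != i0.
  apply: contraNneq cV => czi; rewrite -(setD1K zV) imsetU1 cVz czi.
  by apply/eqP/setP => i; rewrite !inE; case: eqP.
have [w wV cw] : exists2 w, w \in V :\ z & c z = c w.
  by apply/imsetP; rewrite cVz !inE.
have wz : w != z by move: wV; rewrite !inE => /andP[].
suff -> : [set z in V | c @: (V :\ z) == [set~ i0]] = [set z; w].
  by rewrite cards2 eq_sym wz.
apply/setP => t; rewrite in_set2 inE; apply/andP/orP => [[tV /eqP cVt]|].
  have [->|tz] := eqVneq t z; [by left|right].
  have tVz : t \in V :\ z by rewrite !inE tz.
  have /imsetP[s] : c t \in c @: (V :\ t) by rewrite cVt -cVz imset_f.
  rewrite !inE => /andP[st sV] cts; have [sz|sz] := eqVneq s z.
    by apply/eqP/c_inj => //; rewrite cts sz -cw.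
  by case/eqP: st; apply: c_inj; rewrite // ?inE ?sz.
case=> /eqP->; first by rewrite zV cVz eqxx.
have wV' : w \in V by move: wV; rewrite !inE => /andP[].
split=> //; apply/eqP/setP => i; rewrite -cVz; apply/imsetP/imsetP => -[s].
  rewrite !inE => /andP[sw sV] ->; have [->|sz] := eqVneq s z.
    by exists w.
  by exists s; rewrite // !inE sz.
rewrite !inE => /andP[sz sV] ->; have [->|sw] := eqVneq s w.
  by exists z; rewrite // !inE eq_sym wz.
by exists s; rewrite // !inE sw.
Qed.

(** Scarf's lemma.  Count the pairs of a room and a door inside it, keeping the
    doors whose colors are exactly those other than [i0].  Counted by doors, the
    number is odd, since [slack_but i0] is the only boundary door with these
    colors.  Counted by rooms, it would be even if no room had all colors. *)
Theorem scarf_colorful : 0 < #|I| ->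
  exists U, [/\ dominant U, #|U| = #|I| & c @: U = setT].
Proof.
case/card_gt0P=> i0 _.
have [/exists_inP[U domU /andP[/eqP cardU /eqP cU]]|no_col] :=
  boolP [exists U in dominant, (#|U| == #|I|) && (c @: U == setT)].
  by exists U.
pose door (U : {set Z}) :=
  [&& dominant U, #|U|.+1 == #|I| & c @: U == [set~ i0]].
pose N := \sum_(U | door U) #|[set z | (z \notin U) && dominant (z |: U)]|.
have cardS : #|slack_but i0|.+1 = #|I|.
  by rewrite card_imset// cardsC1 prednK//; apply/card_gt0P; exists i0.
have slack_butE i : c @: slack_but i = [set~ i].
  rewrite -imset_comp; apply/setP => j; apply/imsetP/idP => [[k kS ->]|jS].
    by rewrite /= c_e.
  by exists j => //=; rewrite c_e.
have : odd N.
  rewrite /N (bigD1 (slack_but i0)) /=; last first.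
    by rewrite /door dominant_slack_but cardS slack_butE !eqxx.
  rewrite card_rooms_slack_but oddD /=; apply/negP.
  rewrite (big_morph odd oddD (erefl : odd 0 = false)).
  rewrite big1 // => U /andP[/and3P[domU /eqP cardU /eqP cU] US].
  rewrite card_rooms_regular// => i; apply: contraNneq US => Ui.
  by rewrite Ui; have := cU; rewrite Ui slack_butE => /setC_inj/set1_inj ->.
suff : ~~ odd N by move/negPf->.
(* The pair of a door [U] and a new element [z] is the same as the pair of the
   room [V = z |: U] and its element [z]. *)
have -> : N = \sum_(V : {set Z} | dominant V && (#|V| == #|I|))
    #|[set z in V | c @: (V :\ z) == [set~ i0]]|.
  rewrite /N; under eq_bigr do rewrite -sum1dep_card.
  under [RHS]eq_bigr do rewrite -sum1dep_card.
  rewrite (exchange_big_dep xpredT) //= [RHS](exchange_big_dep xpredT) //=.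
  apply: eq_bigr => z _.
  rewrite (reindex_onto (fun V : {set Z} => V :\ z) (setU [set z])); last first.
    by move=> U /and3P[_ zU _]; rewrite setU1K.
  apply: eq_bigl => V; have [zV|zV] := boolP (z \in V); last first.
    rewrite andbF; apply/negP => /andP[_ /eqP VE].
    by case/negP: zV; rewrite -VE setU11.
  rewrite setD1K// eqxx andbT !inE eqxx /=.
  rewrite (cardsD1 z V) zV add1n /door.
  have [domV|_] := boolP (dominant V); last by rewrite andbF.
  by rewrite (dominantS _ domV) ?subD1set//= andbT.
rewrite (big_morph odd oddD (erefl : odd 0 = false)).
rewrite big1 // => V /andP[domV /eqP cardV]; apply: negbTE.
apply: card_doors_even => //.
apply: contraNneq no_col => cV; apply/exists_inP.
by exists V => //; rewrite cardV cV !eqxx.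
Qed.
End Scarf.

(** * Colored grids in the simplex *)

Section Grid.
Variables n N : nat.
Local Notation I := 'I_n.+1.
Local Notation point := {ffun I -> 'I_N.+1}.
(** The points of the standard simplex with coordinates in [N^-1 * nat]. *)
Definition grid := {x : point | \sum_i x i == N}.

Definition gcoord (x : grid) (i : I) : nat := val x i.
Definition code (x : grid) : nat := enum_rank x.
Definition ncode := #|{: grid}|.

Lemma coord_le x i : gcoord x i <= N. Proof. by rewrite -ltnS ltn_ord. Qed.

Lemma sum_coord x : \sum_i gcoord x i = N. Proof. exact: eqP (valP x). Qed.

Lemma code_lt x : code x < ncode. Proof. exact: ltn_ord. Qed.

Lemma code_inj : injective code.
Proof. by move=> x y /val_inj/enum_rank_inj. Qed.

(** The order by the [i]-th coordinate, with ties broken by an arbitrary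
    enumeration of the grid; [inr j] is the slack element of the index [j]. *)
Definition grid_rank (i : I) (z : grid + I) : nat :=
  match z with
  | inl x => gcoord x i * ncode + code x + 1
  | inr j => if j == i then 0 else N.+1 * ncode + 1 + j
  end.

Lemma grid_rank_bound i x : grid_rank i (inl x) < N.+1 * ncode + 1.
Proof.
have : gcoord x i * ncode <= N * ncode by rewrite leq_mul2r coord_le orbT.
by rewrite /=; have := code_lt x; lia.
Qed.

Lemma grid_rank_inj i : injective (grid_rank i).
Proof.
move=> [x|j] [y|k] /=.
- move=> eq_xy; congr inl; apply/code_inj.
  have := congr1 (modn^~ ncode) (addIn eq_xy).
  by rewrite !modnMDl !modn_small ?code_lt.
- have := grid_rank_bound i x => /=; case: ifP => _; lia.
- have := grid_rank_bound i y => /=; case: ifP => _; lia.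
case: eqVneq => [->|ji]; case: eqVneq => [->|ki] //; try lia.
by move/addnI/val_inj->.
Qed.

Lemma grid_rank_le i x y :
  grid_rank i (inl x) <= grid_rank i (inl y) -> gcoord x i <= gcoord y i.
Proof.
rewrite /= leq_add2r => le_xy; rewrite leqNgt; apply/negP => lt_yx.
have : (gcoord y i).+1 * ncode <= gcoord x i * ncode.
  by rewrite leq_mul2r lt_yx orbT.
by have := code_lt y; lia.
Qed.

Lemma grid_of_coords (y : I -> nat) : \sum_i y i = N ->
  exists x : grid, forall i, gcoord x i = y i.
Proof.
move=> sum_y.
have y_le i : y i < N.+1 by rewrite ltnS -sum_y (bigD1 i) //= leq_addr.
pose x : point := [ffun i => inord (y i)].
have sum_x : \sum_i x i == N.
  by rewrite -[eqbRHS]sum_y; apply/eqP/eq_bigr => i _; rewrite ffunE inordK.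
exists (exist (fun x : point => \sum_i x i == N) x sum_x) => i.
by rewrite /gcoord /= ffunE inordK.
Qed.

(** For every coloring there is a grid point [z] such that, for each color [i],
    either [z] is close to the face [x_i = 0] or a point of color [i] is close
    to [z].  This follows from a room with all colors.  Let [m] be the lower
    corner of its proper points, with [m_i = 0] where the room contains the
    slack element [i].  By dominance no grid point exceeds [m] in all the other
    coordinates, and this forces [\sum_i m i + n >= N], so that the proper
    points of the room lie within [n] grid steps of [m]. *)
Lemma grid_covering (c : grid -> I) :
  exists z : grid, forall i, gcoord z i <= n \/
    exists x : grid, c x = i /\
      forall j, gcoord x j <= gcoord z j + n /\ gcoord z j <= gcoord x j + n.
Proof.
have [|x0 _] := @grid_of_coords (fun i => if i == ord0 then N else 0).
  by rewrite -big_mkcond big_pred1_eq.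
pose c' (z : grid + I) := match z with inl x => c x | inr i => i end.
have [||||||U [/dominantP domU _ cU]] :=
    @scarf_colorful I (grid + I)%type grid_rank inr grid_rank_inj
      _ _ _ (inl x0) _ c' _.
- by move=> i j [].
- by move=> i z; rewrite /= eqxx.
- move=> i j [x|k] ji; last by rewrite codom_f.
  by move=> _; have := grid_rank_bound i x; rewrite /= (negPf ji); lia.
- by apply/codomP => -[].
- by [].
- by rewrite card_ord.
have active y : exists i, inr i \notin U /\
    forall u, u \in U -> grid_rank i (inl y) <= grid_rank i u.
  have [i le_y] := domU (inl y); exists i; split => //; apply/negP => /le_y.
  by rewrite /= eqxx; lia.
have colored i : inr i \notin U -> exists2 x, inl x \in U & c x = i.
  move=> iU; have /imsetP[[x|j] zU def_i] : i \in c' @: U by rewrite cU inE.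
    by exists x.
  by rewrite def_i zU in iU.
have [i1 [i1U _]] := active x0; have [z zU _] := colored i1 i1U.
pose mx i := [arg min_(x < z | inl x \in U) gcoord x i].
have mxP i : inl (mx i) \in U /\
    forall x, inl x \in U -> gcoord (mx i) i <= gcoord x i.
  by rewrite /mx; case: arg_minnP.
pose m i := if inr i \in U then 0 else gcoord (mx i) i.
have m_le x i : inl x \in U -> m i <= gcoord x i.
  by rewrite /m; case: ifP => // _; apply: (mxP i).2.
have sum_m : N <= \sum_i m i + n.
  rewrite leqNgt; apply/negP => lt_mN.
  (* Otherwise [m i + 1] at the active indices leaves space for a grid point,
     whose surplus [d] is put on the index [i1]. *)
  pose s i := if inr i \in U then 0 else 1.
  pose d := N - \sum_i (m i + s i).
  have sum_s : \sum_i s i <= n.+1.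
    apply: (@leq_trans (\sum_(i < n.+1) 1)); last by rewrite sum1_card card_ord.
    by apply: leq_sum => i _; rewrite /s; case: ifP.
  have [|y yE] :=
    @grid_of_coords (fun i => m i + s i + (if i == i1 then d else 0)).
    rewrite big_split /= -[X in _ + X]big_mkcond big_pred1_eq /d subnKC//.
    by rewrite big_split /= (leq_trans _ lt_mN)// -addnS leq_add2l.
  have [i [iU le_y]] := active y.
  have := grid_rank_le (le_y _ (mxP i).1).
  by rewrite yE /m /s (negPf iU) /=; lia.
have le_m x i : inl x \in U -> gcoord x i <= m i + n.
  move=> xU; have := sum_coord x; rewrite (bigD1 i) //= => sum_x.
  rewrite -(leq_add2r (\sum_(j < n.+1 | j != i) gcoord x j)) sum_x.
  apply: leq_trans sum_m _; rewrite (bigD1 i) //= [leqRHS]addnAC leq_add2r.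
  by rewrite leq_add2l; apply: leq_sum => j _; apply: m_le.
exists z => i; have [iU|iU] := boolP (inr i \in U).
  by left; have := le_m z i zU; rewrite /m iU.
right; have [x xU cx] := colored i iU; exists x; split=> // j.
have := (le_m x j xU, le_m z j zU, m_le x j xU, m_le z j zU).
by move=> [[[]]]; lia.
Qed.
End Grid.

From mathcomp Require Import all_order all_algebra complex.
From mathcomp Require Import all_classical all_reals all_analysis.

Import Order.TTheory GRing.Theory Num.Theory.
Import numFieldNormedType.Exports.

Local Open Scope classical_set_scope.
Local Open Scope ring_scope.

(** * A covering theorem for the simplex *)

Section Simplex.
Variables (R : realType) (n : nat).

Definition simplex : set 'rV[R]_n.+1 :=
  [set l | (forall i, 0 <= l 0 i) /\ \sum_i l 0 i = 1].

Lemma simplex_compact : compact simplex.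
Proof.
have coordC i : continuous (fun l : 'rV[R]_n.+1 => l 0 i).
  by move=> l; apply: coord_continuous.
apply: (@subclosed_compact _ _
  [set l : 'rV[R]_n.+1 | forall i, `[0, 1]%classic (l ord0 i)]).
- have -> : simplex = (\bigcap_i [set l | 0 <= l 0 i]) `&`
      [set l | \sum_i l 0 i = 1].
    by apply/seteqP; split=> l [l0 l1]; split=> // i *; exact: l0.
  apply: closedI.
    apply: closed_bigI => i _.
    by apply: preimage_closed (@closed_ge R 0) => l _; apply: coordC.
  apply: preimage_closed (@closed_eq R 1) => l _.
  have := @cvg_big R^o 'I_n.+1 +%R 0 xpredT add_continuous _ (nbhs l)
    (index_enum _) (fun i x => x 0 i) (fun i => l 0 i) (nbhs_filter l)
    (fun i _ => coordC i l).
  exact.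
- apply: (@rV_compact R^o n.+1 (fun=> `[0, 1]%classic)) => _.
  exact: segment_compact.
move=> l [l0 l1] i; rewrite /= in_itv/= l0 -l1 (bigD1 i) //= lerDl.
by apply: sumr_ge0.
Qed.

(** The closed covering theorem dual to that of Knaster, Kuratowski and
    Mazurkiewicz: here [G i] contains the face opposite to the vertex [i].
    Color each grid point by a set that contains it; a limit [l] of the points
    given by [grid_covering] belongs to every [G i], as a limit of points of
    color [i] or because [l 0 i = 0]. *)
Lemma simplex_covering (G : 'I_n.+1 -> set 'rV[R]_n.+1) :
  (forall i, closed (G i)) ->
  (forall l, simplex l -> exists i, G i l) ->
  (forall l i, simplex l -> l 0 i = 0 -> G i l) ->
  exists2 l, simplex l & forall i, G i l.
Proof.
move=> closedG coverG faceG.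
pose pt N (x : grid n N.+1) : 'rV[R]_n.+1 :=
  \row_i ((gcoord x i)%:R / N.+1%:R).
have pt_simplex N (x : grid n N.+1) : simplex (pt N x).
  split=> [i|]; first by rewrite mxE divr_ge0.
  under eq_bigr do rewrite mxE; rewrite -mulr_suml -natr_sum sum_coord.
  by rewrite divff// pnatr_eq0.
pose color N (x : grid n N.+1) := projT1 (cid (coverG _ (pt_simplex N x))).
have colorP N x : G (color N x) (pt N x) by rewrite /color; case: cid.
pose z N := projT1 (cid (@grid_covering n N.+1 (color N))).
have zP N := projT2 (cid (@grid_covering n N.+1 (color N))).
rewrite -/(z _) in zP.
have [|l [l_simplex l_cluster]] :=
    @simplex_compact (fmap (fun N => pt N (z N)) \oo) _.
  by exists 0%N => // N _; apply: pt_simplex.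
exists l => // i; have [li0|li0] := eqVneq (l 0 i) 0; first exact: faceG.
apply: closedG => B /nbhs_ballP[e /= e0 leB].
have li_gt0 : 0 < l 0 i by rewrite lt_neqAle eq_sym li0 l_simplex.1.
pose d := Num.min e (l 0 i) / 2.
have d0 : 0 < d by rewrite divr_gt0// lt_min e0.
have [N [nN lN]] : exists N, n%:R / N.+1%:R < d /\ ball l d (pt N (z N)).
  have dn : 0 < d / n.+1%:R by rewrite divr_gt0.
  have [N0 _ N0P] := near_infty_natSinv_lt (PosNum dn).
  have [||_ [[N N0N <-] lN]] :=
    l_cluster ((fun N => pt N (z N)) @` [set N | N0 <= N]%N) (ball l d).
  - by exists N0 => // N N0N; exists N.
  - exact: nbhsx_ballx.
  exists N; split=> //; have := N0P N N0N.
  rewrite /= ltr_pdivlMr ?ltr0Sn// => /le_lt_trans; apply.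
  by rewrite mulrC ler_pM2l ?invr_gt0 ?ltr0Sn// ler_nat.
have dE : d + d = Num.min e (l 0 i) by rewrite -splitr.
have d2 : d + d <= e /\ d + d <= l 0 i by rewrite dE !ge_min !lexx orbT.
case: (zP N i) => [zi|[x [xi x_near]]].
  exfalso; have [_ /(_ 0 i)] := lN; rewrite /ball /= mxE.
  apply/negP; rewrite -leNgt ler_normr; apply/orP; left.
  rewrite lerBrDr (le_trans _ d2.2)// lerD2l (le_trans _ (ltW nN))//.
  by rewrite ler_pM2r ?invr_gt0 ?ltr0Sn// ler_nat.
exists (pt N x); split; first by rewrite -xi; apply: colorP.
apply: leB; apply: (@le_ball _ _ _ (d + d)); first exact: d2.1.
apply: (ball_triangle lN); split=> // j k; rewrite !mxE /ball /=.
apply: le_lt_trans nN; rewrite -mulrBl normrM [X in _ * X]ger0_norm//.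
rewrite ler_pM2r ?invr_gt0 ?ltr0Sn// ler_norml lerBlDr lerBrDr.
have [le1 le2] := x_near k.
by rewrite addrC lerBlDr -!natrD !ler_nat [(n + _)%N]addnC le1 le2.
Qed.
End Simplex.

(** * The norm as a real function, and real convex combinations *)

Local Open Scope complex_scope.

Section RealNorm.
Variables (R : realType) (Y : normedModType R[i]).
Implicit Types x y : Y.

(** The norm takes its values in [R[i]], whose order is partial; its real part
    is the same norm as a function to [R]. *)
Definition rnorm y : R := complex.Re `|y|.

Lemma rnormE y : (rnorm y)%:C = `|y|.
Proof. by apply: RRe_real; apply: normr_real. Qed.

Lemma rnorm_ge0 y : 0 <= rnorm y.
Proof. by rewrite -lecR rnormE; exact: normr_ge0. Qed.

Lemma rnorm_eq0 y : rnorm y = 0 -> y = 0.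
Proof. by move=> y0; apply/normr0_eq0; rewrite -rnormE y0. Qed.

Lemma rnorm0 : rnorm 0 = 0.
Proof. by rewrite /rnorm normr0. Qed.

Lemma rnormN y : rnorm (- y) = rnorm y.
Proof. by rewrite /rnorm normrN. Qed.

Lemma rnormD x y : rnorm (x + y) <= rnorm x + rnorm y.
Proof. by rewrite -lecR rmorphD /= !rnormE ler_normD. Qed.

Lemma rnormZ (a : R) y : 0 <= a -> rnorm (a%:C *: y) = a * rnorm y.
Proof.
move=> a0; apply: complexI; rewrite rmorphM /= !rnormE normrZ.
by rewrite ger0_norm// lecR.
Qed.

Lemma rnorm_sum I (s : seq I) (F : I -> Y) :
  rnorm (\sum_(i <- s) F i) <= \sum_(i <- s) rnorm (F i).
Proof.
elim/big_rec2: _ => [|i b y _ le_y]; first by rewrite rnorm0.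
by rewrite (le_trans (rnormD _ _))// lerD2l.
Qed.

Lemma rnorm_continuous : continuous rnorm.
Proof.
move=> y; apply/cvgrPdist_lt => /= e e0; apply/nbhs_ballP.
exists e%:C => /=; first by rewrite ltcR.
move=> x; rewrite -ball_normE /= -rnormE ltcR; apply: le_lt_trans.
rewrite ler_norml; apply/andP; split.
  rewrite lerNl opprB lerBlDr -[in leLHS](subrK y x) -(rnormN (y - x)) opprB.
  exact: rnormD.
by rewrite lerBlDr -[in leLHS](subrK x y) rnormD.
Qed.

Lemma scale_real_continuous y : continuous (fun a : R => a%:C *: y).
Proof.
move=> a; apply/cvgrPdist_lt => /= e e0; apply/nbhs_ballP.
have eE : (complex.Re e)%:C = e by apply: RRe_real; apply: gtr0_real.
have d0 : 0 < complex.Re e / (rnorm y + 1).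
  by rewrite divr_gt0 ?ltr_wpDl ?rnorm_ge0// -ltcR eE.
exists (complex.Re e / (rnorm y + 1)) => // b; rewrite /ball /= => lt_ab.
rewrite -scalerBl -rmorphB normrZ -rnormE normc_def /= expr0n addr0 sqrtr_sqr.
rewrite -rmorphM -eE ltcR.
apply: le_lt_trans (_ : _ <= `|a - b| * (rnorm y + 1)) _.
  by rewrite ler_wpM2l// lerDl.
by rewrite -ltr_pdivlMr// ltr_wpDl// rnorm_ge0.
Qed.

End RealNorm.

Section Convex.
Variables (R : realType) (Y : normedModType R[i]).

(** By definition of the order on [R[i]], every coefficient between [0] and [1]
    is real. *)
Lemma convex_set_realP (K : set Y) : @convex_set R[i] Y K <->
  forall x y (a : R), K x -> K y -> 0 <= a <= 1 ->
    K (a%:C *: x + (1 - a)%:C *: y).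
Proof.
split=> [Kc x y a Kx Ky /andP[a0 a1]|Kc x y a].
  have [a0' a1'] : 0 <= a%:C /\ a%:C <= 1 :> R[i] by rewrite !lecR.
  have := Kc x y (Itv01 a0' a1'); rewrite !inE => /(_ Kx Ky).
  by rewrite rmorphB.
rewrite !inE => Kx Ky; have [a0 a1] : 0 <= a%:num /\ a%:num <= 1 by split.
have aE : (complex.Re a%:num)%:C = a%:num.
  by apply: RRe_real; apply: ger0_real.
have := Kc x y (complex.Re a%:num) Kx Ky; rewrite -!lecR aE a0 a1 => /(_ isT).
by rewrite rmorphB /= aE.
Qed.

(** Arbitrary positive total weight, which lets an induction on [s] go through;
    total weight [1] gives convex combinations. *)
Lemma convex_sum (K : set Y) : @convex_set R[i] Y K ->
  forall (I : eqType) (s : seq I) (w : I -> R) (y : I -> Y),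
    (forall i, 0 <= w i) -> (forall i, K (y i)) -> 0 < \sum_(i <- s) w i ->
  K ((\sum_(i <- s) w i)^-1%:C *: \sum_(i <- s) (w i)%:C *: y i).
Proof.
move=> /convex_set_realP Kc I s w y w0 Ky; elim: s => [|a s IHs].
  by rewrite big_nil ltxx.
rewrite !big_cons; set S := \sum_(i <- s) w i.
have S0 : 0 <= S by apply: sumr_ge0.
have [S_eq0|S_neq0] := eqVneq S 0.
  rewrite S_eq0 addr0 => wa_gt0.
  have -> : \sum_(i <- s) (w i)%:C *: y i = 0.
    apply: big1_seq => i /= si; have /eqP := S_eq0.
    by rewrite psumr_eq0// => /allP/(_ i si) /eqP ->; rewrite scale0r.
  by rewrite addr0 scalerA -rmorphM mulVf ?gt_eqF// scale1r.
have S_gt0 : 0 < S by rewrite lt_neqAle eq_sym S_neq0.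
move=> wS_gt0; have wS : w a + S != 0 by rewrite gt_eqF.
have a01 : 0 <= (w a + S)^-1 * w a <= 1.
  by rewrite mulr_ge0 ?invr_ge0 ?(ltW wS_gt0)//= ler_pdivrMl// mulr1 lerDl.
have aC : 1 - (w a + S)^-1 * w a = (w a + S)^-1 * S.
  by rewrite -[1](mulVf wS) -mulrBr [w a + S - _]addrC addKr.
have := Kc (y a) _ ((w a + S)^-1 * w a) (Ky a) (IHs S_gt0) a01; rewrite aC.
rewrite !scalerA scalerDr -!rmorphM scalerA -mulrA mulfV// mulr1.
by rewrite -rmorphM.
Qed.

Lemma convex_closure (K : set Y) : @convex_set R[i] Y K ->
  @convex_set R[i] Y (closure K).
Proof.
move=> /convex_set_realP Kc; apply/convex_set_realP => x y a clKx clKy a01 B.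
have cx : (a%:C *: z.1 : Y) @[z --> (x, y)] --> a%:C *: x.
  apply: cvgZ; [exact: cvg_cst|exact: cvg_fst].
have cy : ((1 - a)%:C *: z.2 : Y) @[z --> (x, y)] --> (1 - a)%:C *: y.
  apply: cvgZ; [exact: cvg_cst|exact: cvg_snd].
move=> /(cvgD cx cy)[[U V] /= [xU yV] UVB].
have [u [Ku Uu]] := clKx _ xU; have [v [Kv Vv]] := clKy _ yV.
by exists (a%:C *: u + (1 - a)%:C *: v); split; [exact: Kc|exact: (UVB (u, v))].
Qed.
End Convex.

(** * Schauder's fixed point theorem *)

Section Schauder.
Variables (R : realType) (Y : normedModType R[i]).

Definition bary n (y : 'I_n -> Y) (l : 'rV[R]_n) : Y :=
  \sum_i (l 0 i)%:C *: y i.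

Lemma bary_continuous n (y : 'I_n -> Y) : continuous (bary y).
Proof.
move=> l; have cvg_term i : (fun m : 'rV[R]_n => (m 0 i)%:C *: y i) @ l -->
    (l 0 i)%:C *: y i.
  exact: (@continuous_cvg _ _ _ _ (nbhs_filter l) (fun m : 'rV[R]_n => m 0 i)
    (fun a : R => a%:C *: y i) _ (@scale_real_continuous R Y (y i) _)
    (@coord_continuous _ _ _ _ _ l)).
have := @cvg_big Y 'I_n +%R 0 xpredT add_continuous _ (nbhs l) (index_enum _)
  (fun i m => (m 0 i)%:C *: y i) _ (nbhs_filter l) (fun i _ => cvg_term i).
exact.
Qed.

Lemma bary_convex n (y : 'I_n.+1 -> Y) (K : set Y) l :
  @convex_set R[i] Y K -> (forall i, K (y i)) -> simplex l -> K (bary y l).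
Proof.
move=> /convex_sum Kc Ky [l0 l1].
have := Kc _ (index_enum _) (fun i => l 0 i) y l0 Ky.
by rewrite l1 ltr01 invr1 scale1r; apply.
Qed.

Lemma simplex_weighted_lt n (l : 'rV[R]_n.+1) (f : 'I_n.+1 -> R) (d : R) :
  simplex l -> (forall i, 0 < l 0 i -> f i < d) -> \sum_i l 0 i * f i < d.
Proof.
move=> [l0 l1] lt_fd.
have le_fd i : l 0 i * f i <= l 0 i * d.
  have := l0 i; rewrite le0r => /predU1P[->|li]; first by rewrite !mul0r.
  by rewrite ler_pM2l// ltW// lt_fd.
have dE : \sum_i l 0 i * d = d by rewrite -mulr_suml l1 mul1r.
rewrite -[ltRHS]dE lt_neqAle ler_sum// andbT; apply/negP => /eqP eq_sum.
have /eqP : \sum_i (l 0 i * d - l 0 i * f i) = 0 by rewrite sumrB eq_sum subrr.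
rewrite psumr_eq0 => [/allP eq0|i _]; last by rewrite subr_ge0.
have : \sum_i l 0 i = 0.
  apply: big1 => i _; apply/eqP; have := l0 i; rewrite le0r => /orP[//|li].
  have := eq0 i (mem_index_enum i); rewrite /= -mulrBr mulf_eq0 => /orP[//|].
  by rewrite subr_eq0 gt_eqF// lt_fd.
by rewrite l1 => /eqP; rewrite oner_eq0.
Qed.

Lemma rnorm_bary_lt n (y : 'I_n.+1 -> Y) (z : Y) (d : R) l : simplex l ->
  (forall i, 0 < l 0 i -> rnorm (z - y i) < d) -> rnorm (z - bary y l) < d.
Proof.
move=> lS lt_d; apply: le_lt_trans (simplex_weighted_lt lS lt_d).
have [l0 l1] := lS.
have -> : z - bary y l = \sum_i (l 0 i)%:C *: (z - y i).
  under eq_bigr do rewrite scalerBr.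
  by rewrite sumrB -scaler_suml -rmorph_sum l1 scale1r.
apply: le_trans (rnorm_sum _ _) _.
by apply: ler_sum => i _; rewrite rnormZ.
Qed.

Lemma closed_ge0_within (T : topologicalType) (D : set T) (g : T -> R) :
  closed D -> (forall x, D x -> g @ within D (nbhs x) --> g x) ->
  closed [set x | D x /\ 0 <= g x].
Proof.
move=> clD g_cont x clx; have Dx : D x.
  by apply: clD => B /clx[y [[Dy _] By]]; exists y.
split=> //; rewrite leNgt; apply/negP => gx_lt0.
have near_lt0 := @cvgr_lt R T (within D (nbhs x))
  (within_filter D (nbhs_filter x)) g _ (g_cont x Dx) 0 gx_lt0.
have [y [[Dy gy_ge0] /(_ Dy)]] := clx _ near_lt0.
by rewrite ltNge gy_ge0.
Qed.

Section FixedPoint.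
Variables (K : set Y) (f : Y -> Y).
Hypothesis K_convex : @convex_set R[i] Y K.
Hypothesis fK : forall x, K x -> K (f x).
Hypothesis f_cont : forall x, K x -> f @ within K (nbhs x) --> f x.

Let defect (y x : Y) : R := rnorm (f x - x) - rnorm (f x - y).

Let defect_cont y x : K x -> defect y @ within K (nbhs x) --> defect y x.
Proof.
move=> Kx; have fx := f_cont Kx.
have idx : x0 @[x0 --> within K (nbhs x)] --> x by apply: cvg_within.
apply: cvgB.
  by apply: continuous_cvg; [exact: rnorm_continuous|exact: cvgB].
apply: continuous_cvg; first exact: rnorm_continuous.
by apply: cvgB => //; exact: cvg_cst.
Qed.

(** The finite case of [schauder].  Put [phi i = max 0 (defect (y i))] along the
    barycentric map and let [G i] be the set where
    [l_i * \sum_j phi j <= phi i].  These sets cover the simplex, because both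
    sides have the same sum over [i], and they contain the faces [l_i = 0].  At
    a common point the inequalities are equalities.  If [\sum_j phi j] were
    positive there, each [y i] of positive weight would be closer to [f x] than
    [x], although [x] is a convex combination of them.  So every [phi i]
    vanishes. *)
Lemma best_approx_finite n (y : 'I_n.+1 -> Y) : (forall i, K (y i)) ->
  exists2 x, K x & forall i, rnorm (f x - x) <= rnorm (f x - y i).
Proof.
move=> Ky; pose phi i l : R := Num.max 0 (defect (y i) (bary y l)).
have phi_ge0 i l : 0 <= phi i l by rewrite le_max lexx.
have Kb l : simplex l -> K (bary y l) by apply: bary_convex.
pose D := @simplex R n.
have bary_in l :
    D l -> bary y @ within D (nbhs l) --> within K (nbhs (bary y l)).
  move=> lD A nearA; have := @bary_continuous _ y l _ nearA => {}nearA.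
  rewrite /fmap /within /=; apply: (@filterS _ (nbhs l) _ _ _ _ nearA).
  by move=> m mA mD; apply: mA; apply: Kb.
have phi_cont i l : D l -> phi i @ within D (nbhs l) --> phi i l.
  move=> lD; have : defect (y i) (bary y m) @[m --> within D (nbhs l)] -->
      defect (y i) (bary y l).
    by apply: cvg_comp (bary_in l lD) (defect_cont (Kb l lD)).
  apply: (@continuous_cvg _ R^o R^o _ (within_filter D (nbhs_filter l)) _
    (fun a => Num.max 0 a)).
  apply: (@continuous_max _ R^o (fun=> 0) id); first exact: cvg_cst.
  exact: cvg_id.
pose g i l := phi i l - l 0 i * \sum_j phi j l.
have g_cont i l : D l -> g i @ within D (nbhs l) --> g i l.
  move=> lD; apply: cvgB; first exact: phi_cont.
  apply: cvgM; first by apply: cvg_within_filter; apply: coord_continuous.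
  have := @cvg_big R^o 'I_n.+1 +%R 0 xpredT add_continuous _ _ (index_enum _)
    phi (fun j => phi j l) (within_filter D (nbhs_filter l)).
  by apply=> j _; apply: phi_cont.
have sum_g l : D l -> \sum_i g i l = 0.
  by case=> _ l1; rewrite sumrB -mulr_suml l1 mul1r subrr.
have [|l lD|l i lD li0|l lD lG] :=
    @simplex_covering R n (fun i => [set l | D l /\ 0 <= g i l]).
- move=> i; apply: closed_ge0_within (g_cont i).
  by apply: compact_closed; [exact: norm_hausdorff|exact: simplex_compact].
- apply/not_existsP => g_lt0; have : \sum_i g i l < \sum_(i < n.+1) 0.
    apply: ltr_sum => [|i _]; last first.
      by rewrite ltNge; apply/negP => gi_ge0; apply: (g_lt0 i).
    by apply/hasP; exists ord0; rewrite ?mem_index_enum.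
  by rewrite sum_g// big1// ltxx.
- by split=> //; rewrite /g li0 mul0r subr0.
have phiE i : phi i l = l 0 i * \sum_j phi j l.
  have /eqP := sum_g l lD; rewrite psumr_eq0 => [/allP/(_ i)|j _]; last first.
    by case: (lG j).
  by rewrite mem_index_enum subr_eq0 => /(_ isT)/eqP.
exists (bary y l) => [|i]; first exact: Kb.
have [S_eq0|S_neq0] := eqVneq (\sum_j phi j l) 0.
  have : phi i l <= 0 by rewrite phiE S_eq0 mulr0.
  by rewrite ge_max lexx subr_le0.
have S_gt0 : 0 < \sum_j phi j l.
  by rewrite lt_neqAle eq_sym S_neq0; apply: sumr_ge0.
suff : rnorm (f (bary y l) - bary y l) < rnorm (f (bary y l) - bary y l).
  by rewrite ltxx.
apply: rnorm_bary_lt => // j lj.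
have : 0 < phi j l by rewrite phiE mulr_gt0.
by rewrite lt_max ltxx subr_gt0.
Qed.

(** Schauder's fixed point theorem.  The closed sets of the points [x] at least
    as close to [f x] as [y] is, for [y] in [K], have the finite intersection
    property by [best_approx_finite].  A point of all of them is fixed: take
    [y = f x]. *)
Theorem schauder : compact K -> K !=set0 -> exists x, K x /\ f x = x.
Proof.
move=> cptK [x0 Kx0]; have clK := compact_closed (@norm_hausdorff _ Y) cptK.
pose F y := [set x | K x /\ rnorm (f x - x) <= rnorm (f x - y)].
have clF y : closed (F y).
  have -> : F y = [set x | K x /\ 0 <= - defect y x].
    by apply/seteqP; split=> x [Kx le_x]; split=> //; move: le_x;
      rewrite oppr_ge0 subr_le0.
  by apply: closed_ge0_within clK _ => x Kx; apply: cvgN; apply: defect_cont.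
move: (cptK); rewrite compact_In0 => /(_ Y K F)[||x xF].
- by exists F => // y _; apply/seteqP; split=> x [].
- move=> D' D'K; pose s : seq Y := finmap.enum_fset D'.
  have nthK i : K (nth x0 s i).
    have [lt_i|le_i] := ltnP i (size s); last by rewrite nth_default.
    by have := D'K _ (mem_nth x0 lt_i); rewrite inE.
  have [x Kx x_best] :=
    @best_approx_finite (size s) (fun i => nth x0 s i) (fun i => nthK i).
  exists x => y /= ys; split=> //; have lt_y : (index y s < (size s).+1)%N.
    by rewrite ltnS index_size.
  by have := x_best (Ordinal lt_y); rewrite /= nth_index.
have [Kx _] := xF x0 Kx0; exists x; split=> //.
have [_] := xF (f x) (fK Kx); rewrite subrr rnorm0 => le0.
apply/eqP; rewrite -subr_eq0; apply/eqP/rnorm_eq0/eqP.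
by rewrite eq_le le0 rnorm_ge0.
Qed.
End FixedPoint.
End Schauder.

Local Close Scope complex_scope.

(** * Minimal invariant sets and measures of noncompactness *)

Lemma convex_bigcap (R : realType) (Y : lmodType R[i]) (F : set (set Y)) :
  (forall A, F A -> @convex_set R[i] Y A) ->
  @convex_set R[i] Y (\bigcap_(A in F) A).
Proof.
move=> Fc x y a; rewrite !inE => Fx Fy A FA.
by have := Fc A FA x y a; rewrite !inE; apply; [exact: Fx|exact: Fy].
Qed.

Lemma iter_le_fixed (R : realType) (psi : R -> R) (t : R) :
  (forall s t, 0 <= s -> s <= t -> psi s <= psi t) ->
  iter n psi t @[n --> \oo] --> 0 -> 0 <= t -> t <= psi t -> t = 0.
Proof.
move=> psi_nd psi_cvg t0 le_t.
have le_iter n : t <= iter n psi t.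
  by elim: n => //= n IHn; apply: le_trans le_t (psi_nd _ _ t0 IHn).
apply/eqP; rewrite eq_le t0 andbT leNgt; apply/negP => t_gt0.
have [N _ /(_ N (leqnn N))] := cvgr_lt _ psi_cvg _ t_gt0.
by rewrite /= ltNge le_iter.
Qed.

(** [K] is the intersection of all closed convex invariant sets that contain
    [x0].  The closed convex hull of [f @` K `|` [set x0]] is contained in [K],
    hence mapped into [f @` K], so it is one of these sets and contains [K]. *)
Lemma minimal_invariant (R : realType) (Y : normedModType R[i]) (C : set Y)
    (f : Y -> Y) (x0 : Y) :
  @convex_set R[i] Y C -> closed C -> (forall x, C x -> C (f x)) -> C x0 ->
  exists K : set Y, [/\ K `<=` C, closed K, @convex_set R[i] Y K, K x0 &
    (forall x, K x -> K (f x)) /\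
    K `<=` closure (convex_hull (f @` K `|` [set x0]))].
Proof.
move=> C_convex C_closed fC Cx0.
pose adm A := [/\ closed A, @convex_set R[i] Y A, A x0 &
  forall x, A x -> A (f x)].
pose K := \bigcap_(A in adm) A.
have subK A : adm A -> K `<=` A by move=> admA x; apply.
have admK : adm K.
  split.
  - by apply: closed_bigI => A [].
  - by apply: convex_bigcap => A [].
  - by move=> A [].
  - by move=> x Kx A admA; have [_ _ _ fA] := admA; apply: fA; apply: Kx.
have [K_closed K_convex Kx0 fK] := admK.
exists K; split=> //; first exact: subK.
split=> //; set H := convex_hull _.
have subH : f @` K `|` [set x0] `<=` closure H.
  by apply: subset_trans (@subset_closure _ _); apply: sub_smallest.
have H_convex : @convex_set R[i] Y H by apply: convex_bigcap => A [].
have HK : closure H `<=` K.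
  rewrite [X in _ `<=` X](closure_id K).1//; apply: closureS.
  by apply: smallest_sub => // x [[y Ky <-]|->//]; apply: fK.
apply: subK; split; first exact: closed_closure.
- exact: convex_closure.
- by apply: subH; right.
- by move=> x /HK Kx; apply: subH; left; exists x.
Qed.

Theorem theorem13 (R : realType) (Y : completeNormedModType R[i])
    (Omega : set Y -> \bar R) (HOmega : noncompactness_measure Omega)
    (C : set Y) (C_neq0 : C !=set0) (C_convex : @convex_set R[i] Y C)
    (C_bounded : bounded_set C) (C_closed : closed C)
    (C_fin : (Omega C < +oo)%E)
    (psi : R -> R)
    (psi_ge0 : forall t, 0 <= t -> 0 <= psi t)
    (psi_nondecreasing : forall s t, 0 <= s -> s <= t -> psi s <= psi t)
    (psi_iter : forall t, 0 <= t -> iter n psi t @[n --> \oo] --> (0 : R))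
    (Phi : Y -> Y) (Phi_C : forall x, C x -> C (Phi x))
    (Phi_continuous : {within C, continuous Phi})
    (Phi_contractive : forall A : set Y, A `<=` C ->
      (Omega (Phi @` A) <= (psi (fine (Omega A)))%:E)%E) :
  exists x, C x /\ Phi x = x.
Proof.
have [x0 Cx0] := C_neq0.
have [K [KC K_closed K_convex Kx0 [fK K_hull]]] :=
  minimal_invariant C_convex C_closed Phi_C Cx0.
(* Adding one point changes nothing: [mnc_finite] asks for disjointness, so the
   case of a point already present is treated apart. *)
have Omega_hull : Omega (Phi @` K `|` [set x0]) = Omega (Phi @` K).
  have [x0K|x0K] := pselect ((Phi @` K) x0).
    by congr Omega; apply/setUidl => _ ->.
  rewrite setUC; apply: (mnc_finite HOmega); first exact: finite_set1.
  by apply/seteqP; split=> // _ [->] /x0K.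
have Omega_le : (Omega K <= (psi (fine (Omega K)))%:E)%E.
  apply: le_trans (mnc_le HOmega K_hull) _.
  rewrite (mnc_closure HOmega) (mnc_convex_hull HOmega) Omega_hull.
  exact: Phi_contractive.
have Omega_fin : Omega K \is a fin_num.
  rewrite ge0_fin_numE ?(mnc_ge0 HOmega)//.
  exact: le_lt_trans (mnc_le HOmega KC) C_fin.
have t0 : 0 <= fine (Omega K) by rewrite fine_ge0// (mnc_ge0 HOmega).
have Omega0 : Omega K = 0%E.
  rewrite -(fineK Omega_fin); congr EFin.
  apply: (@iter_le_fixed R psi) => //; first exact: psi_iter.
  by rewrite -lee_fin fineK.
have K_compact : compact K.
  by rewrite -(precompact_closed K_closed); apply/(mnc_eq0 HOmega).
have [x [Kx fx]] : exists x, K x /\ Phi x = x.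
  apply: schauder => //; last by exists x0.
  move=> x Kx.
  have := (subspace_continuousP C Phi).1 Phi_continuous x (KC x Kx).
  by apply: cvg_trans; apply: cvg_fmap2; apply: within_subset.
by exists x; split=> //; apply: KC.
Qed.
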